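(* Let $Y$ be a non-compact metrizable space, $X$ a $Y$-Tychonoff space of countable pseudocharacter, and let $H$ be a subspace of $B(X,Y)$ containing $B_1^{st}(X,Y)$. Then the following assertions are equivalent: (i) $H$ is metrizable and $H=Y^X$; (ii) $H$ is a $k$-space; (iii) $H$ has countable tightness; (iv) $H$ is a $\sigma$-space; (v) $H$ has countable $cs^\ast$-character; (vi) $X$ is countable.
   Context: $X$ is $Y$-Tychonoff if for every closed $A\subseteq X$, point $y_0\in Y$ and function $f:F\to Y$ on a finite set $F\subseteq X\setminus A$ there is a continuous $\bar f:X\to Y$ with $\bar f|_F=f$ and $\bar f(A)\subseteq\{y_0\}$. Countable pseudocharacter: every point is the intersection of countably many open sets. $B_0(X,Y)=C(X,Y)$ is the set of continuous functions; for a nonzero countable ordinal $\alpha$, $B_\alpha(X,Y)$ is the set of functions $X\to Y$ that are pointwise limits of sequences from $\bigcup_{\beta<\alpha}B_\beta(X,Y)$; $B(X,Y)=\bigcup_{\alpha<\omega_1}B_\alpha(X,Y)$. $B_1^{st}(X,Y)$ is the set of all $f:X\to Y$ for which there is a sequence $\{f_n\}$ in $C(X,Y)$ stably converging to $f$, i.e. for every $x\in X$ the set $\{n: f_n(x)\ne f(x)\}$ is finite. All these sets carry the topology of pointwise convergence inherited from $Y^X$. A space $Z$ is a $k$-space if for each non-closed $A\subseteq Z$ there is a compact $K$ such that $A\cap K$ is not closed in $K$; it has countable tightness if whenever $a\in\overline A$ there is a countable $B\subseteq A$ with $a\in\overline B$. A family $\mathcal N$ of subsets of $Z$ is a network if for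 each $z\in Z$ and each neighborhood $O$ of $z$ there is $N\in\mathcal N$ with $z\in N\subseteq O$. $Z$ is a $\sigma$-space if it has a $\sigma$-locally finite network (a network that is a countable union of locally finite families). A family $\mathcal N$ is a $cs^\ast$-network at $z\in Z$ if for each sequence $(z_n)$ converging to $z$ and each neighborhood $O$ of $z$ there is $N\in\mathcal N$ with $z\in N\subseteq O$ and $\{n: z_n\in N\}$ infinite. $Z$ has countable $cs^\ast$-character if it has a countable $cs^\ast$-network at each point. *)

(* Defs.v *)
From HB Require Import structures.
From mathcomp Require Import all_boot all_order all_algebra.
From mathcomp Require Import all_classical all_reals all_analysis.

Set Implicit Arguments.
Unset Strict Implicit.
Unset Printing Implicit Defensive.

Import Order.TTheory GRing.Theory Num.Theory.

Local Open Scope classical_set_scope.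
Local Open Scope ring_scope.

Definition is_metric (R : realType) (T : Type) (d : T -> T -> R) : Prop :=
  [/\ forall x y, 0 <= d x y,
      forall x y, d x y = 0 <-> x = y,
      forall x y, d x y = d y x
    & forall x y z, d x z <= d x y + d y z].

Definition metrizable (R : realType) (T : topologicalType) : Prop :=
  exists d : T -> T -> R,
    is_metric d /\
    forall (x : T) (A : set T),
      nbhs x A <-> exists2 e : R, 0 < e & [set y | d x y < e] `<=` A.

Definition Y_Tychonoff (X Y : topologicalType) : Prop :=
  forall (A F : set X) (y0 : Y) (f : set_type F -> Y),
    closed A -> finite_set F -> F `<=` ~` A ->
    exists g : X -> Y,
      [/\ continuous g,
          forall z : set_type F, g (set_val z) = f z
        & g @` A `<=` [set y0]].

Definition countable_pseudocharacter (X : topologicalType) : Prop :=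
  forall x : X, exists U : nat -> set X,
    (forall n, open (U n)) /\ [set x] = \bigcap_n U n.

Definition strict_well_order (T : Type) (lt : T -> T -> Prop) : Prop :=
  [/\ well_founded lt,
      forall a b c, lt a b -> lt b c -> lt a c
    & forall a b, [\/ lt a b, a = b | lt b a]].

(* Countable ordinals are coded by pairs (lt, a), where lt is a strict        *)
(* well-order on nat and a : nat; the pair stands for the order type alpha of *)
(* the initial segment {b | lt b a}, and the ordinals beta < alpha are those  *)
(* of the pairs (lt, b) with lt b a. Every alpha < omega_1 has such a code,   *)
(* since alpha + omega is the order type of a well-order on nat.              *)
(* Then Baire_class lt a is B_alpha(X, Y).                                    *)
Inductive Baire_class (X Y : topologicalType) (lt : nat -> nat -> Prop) :
    nat -> (X -> Y) -> Prop :=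
  | Baire_class_zero (a : nat) (f : X -> Y) :
      (forall b, ~ lt b a) -> continuous f -> Baire_class lt a f
  | Baire_class_limit (a : nat) (f : X -> Y)
      (b_ : nat -> nat) (f_ : nat -> X -> Y) :
      (forall n, lt (b_ n) a) ->
      (forall n, Baire_class lt (b_ n) (f_ n)) ->
      (forall x : X, (fun n => f_ n x) @ \oo --> f x) ->
      Baire_class lt a f.

Definition Baire_functions (X Y : topologicalType) : set {ptws X -> Y} :=
  [set f | exists (lt : nat -> nat -> Prop) (a : nat),
    strict_well_order lt /\ Baire_class lt a f].

Arguments Baire_functions X Y : clear implicits.

Definition stable_Baire_one (X Y : topologicalType) : set {ptws X -> Y} :=
  [set f | exists f_ : nat -> X -> Y,
    (forall n, continuous (f_ n)) /\
    forall x : X, finite_set [set n | f_ n x <> f x]].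

Arguments stable_Baire_one X Y : clear implicits.

Definition k_space (Z : topologicalType) : Prop :=
  forall A : set Z, ~ closed A ->
    exists2 K : set Z, compact K & ~ closed (A `&` K : set (subspace K)).

Definition countable_tightness (Z : topologicalType) : Prop :=
  forall (A : set Z) (a : Z), closure A a ->
    exists B : set Z, [/\ countable B, B `<=` A & closure B a].

Definition network (Z : topologicalType) (N : set (set Z)) : Prop :=
  forall (z : Z) (O : set Z), nbhs z O ->
    exists M : set Z, [/\ N M, M z & M `<=` O].

Definition locally_finite (Z : topologicalType) (N : set (set Z)) : Prop :=
  forall z : Z, exists2 U : set Z, nbhs z U &
    finite_set [set M | N M /\ M `&` U !=set0].

Definition sigma_space (Z : topologicalType) : Prop :=
  exists N_ : nat -> set (set Z),
    (forall n, locally_finite (N_ n)) /\ network (\bigcup_n N_ n).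

Definition cs_star_network_at (Z : topologicalType) (N : set (set Z)) (z : Z) :
    Prop :=
  forall (z_ : nat -> Z) (O : set Z), z_ @ \oo --> z -> nbhs z O ->
    exists M : set Z,
      [/\ N M, M z, M `<=` O & infinite_set [set n | M (z_ n)]].

Definition countable_cs_star_character (Z : topologicalType) : Prop :=
  forall z : Z, exists2 N : set (set Z), countable N & cs_star_network_at N z.

(* Main.v *)
Require Import Defs.
From mathcomp Require Import all_boot all_order all_algebra.
From mathcomp Require Import all_classical all_reals all_analysis.
From mathcomp Require wochoice.
From mathcomp Require Import lra.

Set Implicit Arguments.
Unset Strict Implicit.
Unset Printing Implicit Defensive.

Import Order.TTheory GRing.Theory Num.Theory.

Local Open Scope classical_set_scope.
Local Open Scope ring_scope.

(** The topology of [X] enters only through the functions that it forces into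
[H].  A finite set [s] is the intersection of open sets [U n] that each point
off [s] eventually leaves, and continuous functions equal to [y] on [s] and to
[c] off [U n] converge stably to the function equal to [y] on [s] and to [c]
elsewhere.  So [H] contains all these two-valued functions
([stable_Baire_one_two_valued]).

If [X] is countable, then continuous functions interpolating an arbitrary [f]
at the first [n] points converge stably to [f].  Hence [H] is the whole
countable power of [Y], which is metrizable, and a metrizable space is a
k-space, has countable tightness and countable [cs*]-character, and is a
sigma-space.  Only the last of these is more than routine: it rests on Stone's
sigma-discrete refinement of the covers by balls ([metrizes_sigma_space]).

Conversely each of the four topological properties makes [X] countable, because
the two-valued functions carry the classical pathologies of uncountable powers.
For tightness these are the functions approximating a constant on finite sets.
For sigma-spaces they are the functions differing from a constant at one point,
all but finitely many of which lie in any given neighbourhood of that constant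
while no two of them fit in the same small set.  For [cs*]-networks a diagonal
sequence of functions with disjoint exceptional sets defeats every member of
the network that controls infinitely many coordinates.  For k-spaces the
non-compactness of [Y] is used: a sequence [y n] without cluster points
([metrizes_noncompact_sequence]) gives Kelley's set of functions equal to [y n]
off at most [n] points, which is not closed but meets every compact set in a
closed set when [X] is uncountable. *)

(** * Sequences and filters *)

Lemma greedy_sequence (T : Type) (P : seq T -> T -> Prop) :
  (forall l, exists t, P l t) ->
  exists t : nat -> T, forall n, P (mkseq t n) (t n).
Proof.
move=> /choice[next nextP].
pose l n := iter n (fun s => rcons s (next s)) [::].
exists (next \o l) => n.
suff -> : mkseq (next \o l) n = l n by exact: nextP.
by elim: n => // n IH; rewrite mkseqS IH.
Qed.

Lemma filter_forall_seq (I : choiceType) (T : Type) (F : set_system T)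
    (s : seq I) (P : I -> set T) :
  Filter F -> (forall i, i \in s -> F (P i)) ->
  F [set t | forall i, i \in s -> P i t].
Proof.
move=> FF; elim: s => [_|i s IH FP].
  by apply: filterS filterT => t _ i; rewrite in_nil.
have FPi : F (P i) by apply: FP; rewrite inE eqxx.
have FPs : F [set t | forall j, j \in s -> P j t].
  by apply: IH => j js; apply: FP; rewrite inE js orbT.
apply: filterS (filterI FPi FPs) => t [Pit Pst] j.
by rewrite inE => /predU1P[->//|]; exact: Pst.
Qed.

Lemma archimedean_inv (R : realType) (e : R) :
  0 < e -> exists N, forall n, (N <= n)%N -> n.+1%:R^-1 < e.
Proof.
move=> e0; have [N _ NP] := near_infty_natSinv_lt (PosNum e0).
by exists N.
Qed.

(** A filter on a convergent sequence together with its limit either clusters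
at the limit or lives on finitely many terms. *)
Lemma compact_convergent_sequence (S : topologicalType) (u : nat -> S) a :
  u @ \oo --> a -> compact (a |` range u).
Proof.
move=> ua F PF FK; have [aF|] := pselect (cluster F a).
  by exists a; split => //; left.
move=> /existsNP[B] /existsNP[U] /not_implyP[FB] /not_implyP[aU].
move=> /set0P/negP/negPn/eqP BU0.
have [N _ NU] := ua _ aU.
have : compact (u @` `I_N) by exact/finite_compact/finite_image/finite_II.
have FuN : F (u @` `I_N).
  apply: filterS (filterI FB FK) => z [Bz Kz].
  have nUz : ~ U z by move=> Uz; rewrite -[False]/(set0 z) -BU0.
  case: Kz => [za|[n _ unz]].
    by case: nUz; rewrite za; exact: nbhs_singleton.
  exists n => //=; rewrite ltnNge; apply/negP => Nn.
  by apply: nUz; rewrite -unz; exact: NU.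
move=> /(_ F PF FuN)[p [[n _ <-] clp]]; exists (u n); split => //.
by right; exists n.
Qed.

(** * Metrizable spaces *)

Definition metrizes (R : realType) (T : topologicalType) (d : T -> T -> R) :=
  is_metric d /\
  forall (x : T) (A : set T),
    nbhs x A <-> exists2 e : R, 0 < e & [set y | d x y < e] `<=` A.

Section metric_space.
Context (R : realType) (T : topologicalType) (d : T -> T -> R).
Hypothesis dT : metrizes d.

Let dge0 x y : 0 <= d x y. Proof. by case: dT => -[]. Qed.
Let deq0 x y : d x y = 0 <-> x = y. Proof. by case: dT => -[]. Qed.
Let dxx x : d x x = 0. Proof. exact/deq0. Qed.
Let dC x y : d x y = d y x. Proof. by case: dT => -[]. Qed.
Let dtri x y z : d x z <= d x y + d y z. Proof. by case: dT => -[]. Qed.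

Lemma metrizes_nbhsP x A :
  nbhs x A <-> exists2 e : R, 0 < e & [set y | d x y < e] `<=` A.
Proof. by case: dT. Qed.

Lemma metrizes_ball x e : 0 < e -> nbhs x [set y | d x y < e].
Proof. by move=> e0; apply/metrizes_nbhsP; exists e. Qed.

Lemma metrizes_hausdorff : hausdorff_space T.
Proof.
move=> p q pq; apply/deq0/eqP; rewrite eq_le dge0 andbT leNgt.
apply/negP => pq0.
have e0 : 0 < d p q / 2 by lra.
have [z [/= pz qz]] := pq _ _ (metrizes_ball p e0) (metrizes_ball q e0).
have := dtri p z q; rewrite (dC z q); lra.
Qed.

Lemma metrizes_closure_sequence A a : closure A a ->
  exists2 u : nat -> T, (forall n, A (u n)) & u @ \oo --> a.
Proof.
move=> Aa; have invS n : 0 < n.+1%:R^-1 :> R by rewrite invr_gt0.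
have /choice[u uP] n : exists z, A z /\ d a z < n.+1%:R^-1.
  by have [z [Az az]] := Aa _ (metrizes_ball a (invS n)); exists z.
exists u => [n|U /metrizes_nbhsP[e e0 eU]]; first exact: (uP n).1.
have [N NP] := archimedean_inv e0; exists N => // n /= /NP ne.
by apply: eU; exact: lt_trans (uP n).2 ne.
Qed.

Lemma metrizes_countable_tightness : countable_tightness T.
Proof.
move=> A a /metrizes_closure_sequence[u uA ua]; exists (range u); split.
- exact: sub_countable (card_image_le _ _) (countableP _).
- by move=> _ [n _ <-].
- by move=> U /ua[N _ NU]; exists (u N); split; [exists N|apply: NU => /=].
Qed.

Lemma metrizes_k_space : k_space T.
Proof.
move=> A nA; have [a /not_implyP[clAa nAa]] : exists a, ~ (closure A a -> A a).
  exact/existsNP.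
have [u uA ua] := metrizes_closure_sequence clAa.
exists (a |` range u); first exact: compact_convergent_sequence.
move=> /closed_subspaceP[V clV VK]; apply: nAa.
have uV n : V (u n).
  have : ((A `&` (a |` range u)) `&` (a |` range u)) (u n).
    by split; [split|] => //; right; exists n.
  by rewrite -VK => -[].
have Va : V a.
  by apply: clV => U /ua[N _ NU]; exists (u N); split => //; apply: NU => /=.
have : (V `&` (a |` range u)) a by split => //; left.
by rewrite VK => -[[]].
Qed.

Lemma metrizes_countable_cs_star_character : countable_cs_star_character T.
Proof.
move=> z; pose B n := [set y | d z y < n.+1%:R^-1].
exists (range B).
  exact: sub_countable (card_image_le _ _) (countableP _).
move=> u O uz /metrizes_nbhsP[e e0 eO].
have [N NP] := archimedean_inv e0.
have BN : nbhs z (B N) by apply: metrizes_ball; rewrite invr_gt0.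
exists (B N); split.
- by exists N.
- exact: nbhs_singleton.
- by apply: subset_trans eO => y /= /lt_trans; apply; exact: NP.
have [M _ MB] := uz _ BN.
apply: sub_infinite_set (_ : infinite_set (setT `\` `I_M)); last first.
  by apply: infinite_setD; [exact: infinite_nat|exact: finite_II].
by move=> n [_ /negP]; rewrite -leqNgt => /MB.
Qed.

(** Stone's construction.  Well-order the points and, for every radius, let
[c n x] be the least point within distance [1/(n+1)] of [x].  The points [x]
with [c n x = s] that are also [1/(k+1)]-deep inside the ball around [s] form,
as [s] varies, a family any two members of which are at distance at least
[1/(k+1)]: a closer pair would put each of the two centres below the other. *)
Lemma metrizes_sigma_space : sigma_space T.
Proof.
have [le leP] := wochoice.well_ordering_principle T.
have le_refl s : le s s.
  have [|_ [[/eqP-> /(_ s)]]] := leP (pred1 s); first by exists s; exact: eqxx.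
  by move=> /(_ (eqxx _)).
(* Both [s] and [t] would be the least element of the pair. *)
have le_anti s t : le s t -> le t s -> s = t.
  move=> st ts; have [|m [_ mP]] := leP (pred2 s t).
    by exists s; rewrite inE eqxx.
  rewrite -(mP s) ?(mP t) //; split; rewrite ?inE ?eqxx ?orbT //.
    by move=> x; rewrite !inE => /orP[]/eqP->.
  by move=> x; rewrite !inE => /orP[]/eqP->.
pose r n : R := n.+1%:R^-1.
have r0 n : 0 < r n by rewrite invr_gt0.
have /choice[c cP] nx : exists s, d nx.2 s < r nx.1 /\
    forall t, d nx.2 t < r nx.1 -> le s t.
  have [|s [[sP sle] _]] := leP [pred s | d nx.2 s < r nx.1].
    by exists nx.2; rewrite inE dxx r0.
  by exists s; split.
pose E n k s := [set x | c (n, x) = s /\ [set y | d x y < r k] `<=`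
  [set y | d s y < r n]].
have Esep n k s t x y : E n k s x -> E n k t y -> d x y < r k -> s = t.
  move=> [cx xs] [cy yt] xy; apply: le_anti.
    by rewrite -cx; apply: (cP (n, x)).2 => /=; rewrite dC; apply: yt;
      rewrite /= dC.
  by rewrite -cy; apply: (cP (n, y)).2 => /=; rewrite dC; exact: xs.
pose code m : nat * nat := odflt (0, 0)%N (unpickle m).
exists (fun m => range (E (code m).1 (code m).2)); split.
  move=> m z; set n := (code m).1; set k := (code m).2.
  have rk2 : 0 < r k / 2 by have := r0 k; lra.
  exists [set y | d z y < r k / 2]; first exact: metrizes_ball.
  set N := [set M | _].
  have [->|/set0P[M0 [[s _ <-] [x [xs /= zx]]]]] := eqVneq N set0.
    exact: finite_set0.
  apply: sub_finite_set (finite_set1 (E n k s)) => _ [[t _ <-] [y [yt /= zy]]] /=.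
  congr (E n k _); apply: (Esep _ _ _ _ _ _ yt xs).
  have := dtri y z x; rewrite (dC y z); lra.
move=> z O /metrizes_nbhsP[e e0 eO].
have [n /(_ n (leqnn n)) nP] := archimedean_inv (divr_gt0 e0 (ltr0n R 2)).
have [zs _] := cP (n, z); move: zs => /=; set s := c (n, z) => zs.
have [k /(_ k (leqnn k)) kP] : exists N, forall m, (N <= m)%N ->
    m.+1%:R^-1 < r n - d z s by apply: archimedean_inv; rewrite subr_gt0.
exists (E n k s); split.
- exists (pickle (n, k)) => //; exists s => //.
  by rewrite /code pickleK.
- split => // y /= zy; have := dtri s z y; rewrite (dC s z).
  move: zy kP; rewrite -/(r k); lra.
- move=> x [_ /(_ x)] /=; rewrite dxx => /(_ (r0 k)) sx; apply: eO => /=.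
  by have := dtri z s x; move: nP; rewrite -/(r n); lra.
Qed.

(** If every sequence has a cluster point then an ultrafilter contains balls of
every radius, since points avoiding successively more balls would have no
cluster point; a cluster point of the centres of such balls is its limit. *)
Lemma metrizes_noncompact_sequence : ~ compact [set: T] ->
  exists y : nat -> T,
    forall p : T, exists2 U, nbhs p U & \forall n \near \oo, ~ U (y n).
Proof.
apply: contra_notP => nY.
have clY (y : nat -> T) : exists p, forall e, 0 < e -> forall N,
    exists2 n, (N <= n)%N & d p (y n) < e.
  apply: contrapT => /forallNP yP; apply: nY; exists y => p.
  have [e /not_implyP[e0 /existsNP[N NP]]] := (existsNP _).2 (yP p).
  exists [set z | d p z < e]; first exact: metrizes_ball.
  by exists N => // n Nn pn; apply: NP; exists n.
rewrite compact_ultra => F UF _.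
have Fball e : 0 < e -> exists p, F [set z | d p z < e].
  move=> e0; apply: contrapT => /forallNP nF.
  have nball p : F (~` [set z | d p z < e]).
    by case: (in_ultra_setVsetC [set z | d p z < e] UF) => // /nF.
  have [|t tP] := @greedy_sequence T (fun l z => forall p, p \in l -> e <= d p z).
    move=> l; have /filter_ex[z zP] : F [set z | forall p, p \in l ->
        (~` [set z | d p z < e]) z] by apply: filter_forall_seq.
    by exists z => p /zP /negP; rewrite -leNgt.
  have [p pP] := clY t; have e2 : 0 < e / 2 by lra.
  have [n _ pn] := pP _ e2 0%N; have [m nm pm] := pP _ e2 n.+1.
  have : e <= d (t n) (t m) by apply: tP; apply/map_f; rewrite mem_iota.
  have := dtri (t n) p (t m); rewrite (dC _ p); lra.
have /choice[q qP] n : exists p, F [set z | d p z < n.+1%:R^-1].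
  by apply: Fball; rewrite invr_gt0.
have [p pP] := clY q; exists p; split => // U /metrizes_nbhsP[e e0 eU].
have e2 : 0 < e / 2 by lra.
have [N NP] := archimedean_inv e2; have [n /NP ne pn] := pP _ e2 N.
apply: filterS (qP n) => z /= /lt_trans /(_ ne) qz; apply: eU => /=.
by have := dtri p (q n) z; lra.
Qed.

End metric_space.

(** * Metrizability of subspaces and countable powers *)

Lemma metrizable_set_type (R : realType) (Z : topologicalType) (A : set Z) :
  metrizable R Z -> metrizable R (set_type A).
Proof.
move=> [d [[d0 deq dC dtri] dnbhs]].
exists (fun x y => d (set_val x) (set_val y)).
split.
  split=> // x y; split=> [/deq xy|->]; last exact/deq.
  exact: val_inj.
move=> x B; split.
  case=> _ [[U oU <-] Ux UB].
  have /dnbhs[e e0 eU] : nbhs (set_val x) U by exact: open_nbhs_nbhs.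
  by exists e => // y xy; apply: UB; exact: eU.
case=> e e0 eB; have : nbhs x (set_val @^-1` [set z | d (set_val x) z < e]).
  by apply: initial_continuous; apply/dnbhs; exists e.
by apply: filterS => y /eB.
Qed.

Lemma finite_injective_ltn (T : Type) (e : T -> nat) n :
  {in [set: T] &, injective e} -> finite_set [set x | (e x < n)%N].
Proof.
move=> einj; have einj' : {in [set x | (e x < n)%N] &, injective e}.
  by move=> x y _ _; apply: einj; rewrite inE.
rewrite -(eq_finite_set (inj_card_eq einj')).
by apply: sub_finite_set (finite_II n) => _ [x /= xn <-].
Qed.

Lemma cvg_ptws (X Y : topologicalType) (F : set_system {ptws X -> Y})
    (f : {ptws X -> Y}) : Filter F ->
  (forall x, (fun g : {ptws X -> Y} => g x) @ F --> f x) -> F --> f.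
Proof.
move=> FF Ff; apply/cvg_sup => x A [_] [[U oU <-] Ufx UA]; apply: (filterS UA).
by apply: (Ff x U); exact: open_nbhs_nbhs.
Qed.

Lemma ptws_eval_continuous (X Y : topologicalType) (x : X) :
  continuous (fun f : {ptws X -> Y} => f x).
Proof. exact: proj_continuous. Qed.

(** The metric is [sup_x min (d (f x) (g x)) (1 / (e x + 1))] for an injection
[e] of [X] into the natural numbers: a small bound on it constrains only
finitely many coordinates. *)
Lemma metrizable_ptws_countable (R : realType) (X Y : topologicalType) :
  metrizable R Y -> countable [set: X] -> metrizable R {ptws X -> Y}.
Proof.
move=> [d [[d0 deq dC dtri] dnbhs]] /countable_injP[e einj].
pose w x : R := (e x).+1%:R^-1.
have w0 x : 0 < w x by rewrite invr_gt0.
pose t (f g : X -> Y) x := Num.min (d (f x) (g x)) (w x).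
pose S (f g : X -> Y) := 0 |` range (t f g).
have t0 f g x : 0 <= t f g x by rewrite le_min d0 ltW.
have Sub f g : has_ubound (S f g).
  exists 1 => _ [->|[x _ <-]]; first exact: ler01.
  by rewrite ge_min (_ : w x <= 1) ?orbT // invf_le1 // ler1n.
pose D (f g : {ptws X -> Y}) := sup (S f g).
have tD f g x : t f g x <= D f g by apply: ub_le_sup => //; right; exists x.
have D0 f g : 0 <= D f g by apply: ub_le_sup => //; left.
have Dle f g b : 0 <= b -> (forall x, t f g x <= b) -> D f g <= b.
  move=> b0 tb; apply: ge_sup; first by exists 0; left.
  by move=> _ [->//|[x _ <-]].
have tC f g x : t f g x = t g f x by rewrite /t dC.
exists D; split.
  split=> //.
  - move=> f g; split=> [Dfg|->].
      apply/funext => x; apply/deq/eqP; rewrite eq_le d0 andbT.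
      by have := tD f g x; rewrite Dfg ge_min (leNgt (w x)) w0 orbF.
    apply/eqP; rewrite eq_le D0 andbT; apply: Dle => // x.
    by rewrite ge_min (_ : d _ _ = 0) ?lexx //; exact/deq.
  - by move=> f g; apply/eqP; rewrite eq_le; apply/andP; split;
      apply: Dle => // x; rewrite tC.
  - move=> f g h; apply: Dle => [|x]; first exact: addr_ge0.
    apply: le_trans (lerD (tD f g x) (tD g h x)).
    rewrite /t; have := dtri (f x) (g x) (h x); have := w0 x.
    have := d0 (f x) (g x); have := d0 (g x) (h x).
    by rewrite /Num.min; do 3 case: ifP; lra.
move=> f A; split.
  pose F : set_system {ptws X -> Y} :=
    filter_from [set b : R | 0 < b] (fun b => [set g | D f g < b]).
  have FF : Filter F.
    apply: filter_from_filter; first by exists 1; exact: ltr01.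
    move=> a b /= a0 b0; exists (Num.min a b); first by rewrite /= lt_min a0.
    by move=> g /=; rewrite lt_min => /andP[].
  suff Ff : F --> f by move=> fA; exact: (Ff A fA).
  apply: (@cvg_ptws X Y F f FF) => x U /dnbhs[b b0 bU].
  exists (Num.min b (w x)); first by rewrite /= lt_min b0 w0.
  move=> g /= /(le_lt_trans (tD f g x)); rewrite lt_min => /andP[tb tw].
  apply: bU => /=; move: tb tw; rewrite /t /Num.min.
  by case: ifP => //; rewrite ltxx.
case=> b b0 bA; apply: (filterS bA).
have b2 : 0 < b / 2 by lra.
have [N NP] := archimedean_inv b2.
have /finite_seqP[s sP] : finite_set [set x | (e x < N)%N].
  exact: finite_injective_ltn.
have : nbhs f [set g : {ptws X -> Y} |
    forall x, x \in s -> d (f x) (g x) < b / 2].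
  apply: filter_forall_seq => x _.
  have : nbhs (f x) [set y | d (f x) y < b / 2] by apply/dnbhs; exists (b / 2).
  exact: (@ptws_eval_continuous X Y x f).
apply: filterS => g gs /=; apply: (@le_lt_trans _ _ (b / 2)); last lra.
apply: Dle => [|x]; first exact: ltW.
rewrite ge_min; have [xN|/NP/ltW ->] := ltnP (e x) N; last by rewrite orbT.
suff /gs/ltW -> : x \in s by [].
suff : [set` s] x by [].
by rewrite -sP.
Qed.

(** * Functions with finitely many exceptional points *)

Definition two_valued (X Y : eqType) (s : seq X) (y c : Y) : X -> Y :=
  fun x => if x \in s then y else c.

(** Finite sets inherit countable pseudocharacter from points: shrink a
neighbourhood of every point of [s] along the intersection of the first [n]
members of its sequence. *)
Lemma finite_pseudocharacter (X : topologicalType) (s : seq X) :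
  countable_pseudocharacter X ->
  exists U : nat -> set X, [/\ forall n, open (U n),
    forall n x, x \in s -> U n x &
    forall x, x \notin s -> \forall n \near \oo, ~ U n x].
Proof.
move=> /choice[V VP].
pose W x n := [set z | forall i, i \in iota 0 n.+1 -> V x i z].
have Wo x n : open (W x n).
  rewrite openE => z zW; apply: filter_forall_seq => i /zW zV.
  by apply: open_nbhs_nbhs; split=> //; exact: (VP x).1.
exists (fun n => \bigcup_(x in [set` s]) W x n); split.
- by move=> n; apply: bigcup_open => x _.
- move=> n x xs; exists x => // i _.
  have xx : [set x] x by [].
  by move: xx; rewrite {1}(VP x).2 => /(_ i Logic.I).
move=> x xs; have : \forall n \near \oo, forall z, z \in s -> ~ W z n x.
  apply: (@filter_forall_seq X _ _ s (fun z => [set n | ~ W z n x])) => z zs.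
  have : ~ (\bigcap_n V z n) x.
    by rewrite -(VP z).2 => /= xz; rewrite xz zs in xs.
  move=> /existsNP[N] /not_implyP[_ NV].
  exists N => // n /= Nn xW; apply: NV; apply: xW.
  by rewrite mem_iota ltnS.
by apply: filterS => n nW [z /nW].
Qed.

(** Every point off [s] eventually lies in the closed complements of the
neighbourhoods of [s] given by [finite_pseudocharacter], and [Y]-Tychonoff
separation of [s] from these closed sets keeps the value at the point equal to
[c] from then on. *)
Lemma stable_Baire_one_two_valued (X Y : topologicalType) (s : seq X)
    (y c : Y) :
  Y_Tychonoff X Y -> countable_pseudocharacter X ->
  stable_Baire_one X Y (two_valued s y c).
Proof.
move=> XY Xpc; have [U [Uo sU nsU]] := finite_pseudocharacter s Xpc.
have /choice[g gP] n : exists g : X -> Y, [/\ continuous g,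
    forall x, x \in s -> g x = y & forall x, ~ U n x -> g x = c].
  have [| |g [gc gs gU]] := XY (~` U n) [set` s] c (fun=> y) _ (finite_seq s).
  - by rewrite closedC.
  - by rewrite setCK => x; exact: sU.
  exists g; split=> // x.
    by move=> xs; exact: (gs (SigSub (mem_set (xs : [set` s] x)))).
  by move=> Ux; apply: gU; exists x.
exists g; split=> [n|x]; first by case: (gP n).
have [xs|nxs] := boolP (x \in s).
  apply: sub_finite_set (finite_set0 nat) => n /=; case: (gP n) => _ + _.
  by move=> /(_ _ xs) ->; rewrite /two_valued xs.
have [N _ NU] := nsU _ nxs.
apply: sub_finite_set (finite_II N) => n /=.
rewrite /two_valued (negbTE nxs) => gx.
rewrite ltnNge; apply/negP => /NU Ux; apply: gx.
by case: (gP n) => _ _; apply.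
Qed.

Lemma stable_Baire_one_countable (X Y : topologicalType) (y0 : Y) :
  Y_Tychonoff X Y -> countable [set: X] ->
  stable_Baire_one X Y = [set: {ptws X -> Y}].
Proof.
move=> XY /countable_injP[e einj]; rewrite -subTset => f _.
pose P n := [set x | (e x < n)%N].
have finP n : finite_set (P n) by exact: finite_injective_ltn.
have /choice[g gP] n : exists g : X -> Y, continuous g /\
    forall x, P n x -> g x = f x.
  have [||g [gc gP _]] := XY set0 (P n) y0 (fun x => f (set_val x)) _ (finP n).
  - exact: closed0.
  - by rewrite setC0.
  by exists g; split=> // x /mem_set Px; exact: (gP (SigSub Px)).
exists g; split=> [n|x]; first by case: (gP n).
apply: sub_finite_set (finite_II (e x).+1) => n /= gx.
by rewrite ltnNge; apply/negP => en; apply: gx; apply: (gP n).2.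
Qed.

(** * Spaces containing all two-valued functions *)

Section two_valued_space.
Context (X Y : topologicalType) (H : set {ptws X -> Y}).
Hypothesis Y_hausdorff : hausdorff_space Y.
Hypothesis H_two_valued : forall s y c, H (two_valued s y c).

Let tv s y c : set_type H := SigSub (mem_set (H_two_valued s y c)).

Let tv_in s y c x : x \in s -> set_val (tv s y c) x = y.
Proof. by move=> xs; rewrite set_valE /= /two_valued xs. Qed.

Let tv_notin s y c x : x \notin s -> set_val (tv s y c) x = c.
Proof. by move=> xs; rewrite set_valE /= /two_valued (negbTE xs). Qed.

Lemma nbhs_eval (h : set_type H) (x : X) (U : set Y) :
  nbhs (set_val h x) U -> nbhs h [set g : set_type H | U (set_val g x)].
Proof.
move=> /(@ptws_eval_continuous X Y x (set_val h)).
exact: (@initial_continuous (set_type H) {ptws X -> Y} set_val h).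
Qed.

Lemma nbhs_eval_neq (h : set_type H) (x : X) (y : Y) :
  set_val h x <> y -> nbhs h [set g : set_type H | set_val g x <> y].
Proof.
move=> hy; apply: (@nbhs_eval h x [set z | z <> y]).
have cly := accessible_closed_set1 (hausdorff_accessible Y_hausdorff) (x := y).
by apply: open_nbhs_nbhs; split => //; exact: closed_openC.
Qed.

Lemma nbhs_agree (h : set_type H) (U : set (set_type H)) : nbhs h U ->
  exists s : seq X, forall g : set_type H,
    (forall x, x \in s -> set_val g x = set_val h x) -> U g.
Proof.
case=> _ [[V oV <-] /= Vh VU].
pose F : set_system {ptws X -> Y} := filter_from [set: seq X]
  (fun s => [set f | forall x, x \in s -> f x = set_val h x]).
have FF : Filter F.
  apply: filter_from_filter; first by exists [::].
  move=> s t _ _; exists (s ++ t) => // f fst.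
  by split=> x xs; apply: fst; rewrite mem_cat xs ?orbT.
have Fh : F --> (set_val h : {ptws X -> Y}).
  apply: (@cvg_ptws X Y F (set_val h) FF) => x W /nbhs_singleton Wh.
  by exists [:: x] => // f /= ->; rewrite ?inE.
have [s _ sV] : F V by apply: Fh; exact: open_nbhs_nbhs.
by exists s => g /sV Vg; exact: VU.
Qed.

(** The constant [y] is in the closure of the functions equal to [y] at
finitely many points and to [c] elsewhere, and a countable subset of these can
approximate it only at the countably many points where some member is [y]. *)
Lemma countable_tightness_countable (y c : Y) : y <> c ->
  countable_tightness (set_type H) -> countable [set: X].
Proof.
move=> yc tH.
have [|B [cB BA clB]] := tH (range (fun s => tv s y c)) (tv [::] y y).
  move=> U /nbhs_agree[s sU]; exists (tv s y c); split; first by exists s.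
  by apply: sU => x xs; rewrite tv_in.
apply: (@sub_countable _ _ _ (\bigcup_(h in B) [set x | set_val h x = y])).
  apply: subset_card_le => x _.
  have [h [Bh hx]] := clB _ (@nbhs_eval_neq (tv [::] y y) x c yc).
  exists h => //; have [s _ sh] := BA _ Bh; move: hx; rewrite /= -sh.
  by case: (boolP (x \in s)) => [/tv_in|/tv_notin] ->.
apply: bigcup_countable => // _ /BA[s _ <-].
apply: finite_set_countable; apply: sub_finite_set (finite_seq s) => x /= xy.
by apply: contrapT => /negP/(@tv_notin s y c)/=; rewrite xy.
Qed.

(** Some neighbourhood of the constant [c] meets only finitely many members of a
given locally finite family, and it contains all but finitely many of the
functions that differ from [c] in a single point; but members of the network
that separate such functions from [c] at those points are all different. *)
Lemma sigma_space_countable (y c : Y) : y <> c ->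
  sigma_space (set_type H) -> countable [set: X].
Proof.
move=> yc [N_ [lfN netN]].
have /choice[U UP] n : exists U : set (set_type H),
    nbhs (tv [::] c c) U /\ finite_set [set M | N_ n M /\ M `&` U !=set0].
  by have [U] := lfN n (tv [::] c c); exists U.
have /choice[s sP] n : exists s : seq X, forall g : set_type H,
    (forall x, x \in s -> set_val g x = c) -> U n g.
  by have [s sU] := nbhs_agree (UP n).1; exists s.
pose L n := [set M | N_ n M /\ M `&` U n !=set0].
pose P M := [set x | M (tv [:: x] y c) /\ M `<=` [set h | set_val h x <> c]].
apply: (@sub_countable _ _ _
    (\bigcup_n ([set` s n] `|` \bigcup_(M in L n) P M))).
  apply: subset_card_le => x _.
  have [|M [[n _ NM] Mx Mc]] := netN (tv [:: x] y c) [set h | set_val h x <> c].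
    by apply: nbhs_eval_neq; rewrite tv_in ?inE.
  exists n => //; have [xs|xs] := boolP (x \in s n); first by left.
  right; exists M => //; split => //; exists (tv [:: x] y c); split => //.
  apply: sP => z zs; apply: tv_notin; rewrite inE; apply: contra xs.
  by move=> /eqP <-.
apply: bigcup_countable => // n _; apply: finite_set_countable.
rewrite finite_setU; split; first exact: finite_seq.
apply: bigcup_finite; first exact: (UP n).2.
move=> M _; have [->|/set0P[x [Mx _]]] := eqVneq (P M) set0.
  exact: finite_set0.
apply: sub_finite_set (finite_set1 x) => z [_ Mz] /=.
by apply: contrapT => /eqP zx; apply: (Mz _ Mx); apply: tv_notin; rewrite inE.
Qed.

(** Given a countable [cs*]-network [N] at the constant [c], let [S M] be the
set of points [x] such that no function in [M] takes the value [y] at [x].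
Choose pairwise disjoint finite sets [t n] such that [t n] meets [S M] for each
of the first [n] members [M] for which [S M] is infinite.  The functions equal
to [y] on [t n] and to [c] elsewhere converge to [c] and are eventually outside
every such [M], so every [x] lies in one of the finite [S M]. *)
Lemma cs_star_countable (y c : Y) : y <> c ->
  countable_cs_star_character (set_type H) -> countable [set: X].
Proof.
move=> yc /(_ (tv [::] c c))[N cN netN]; have /countable_injP[e einj] := cN.
have [nX|/existsNP[x0 _]] := pselect (forall x : X, False).
  apply: finite_set_countable.
  by apply: sub_finite_set (finite_set0 X) => x _; exact: nX.
pose S (M : set (set_type H)) := [set x | forall h, M h -> set_val h x <> y].
pose L n := [set M | [/\ N M, (e M < n)%N & infinite_set (S M)]].
have finL n : finite_set (L n).
  have einjL : {in L n &, injective e}.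
    move=> M M'; rewrite !inE => -[NM _ _] [NM' _ _].
    by apply: einj; rewrite inE.
  rewrite -(eq_finite_set (inj_card_eq einjL)).
  by apply: sub_finite_set (finite_II n) => _ [M [_ /= en _] <-].
have [l|t tP] := @greedy_sequence (seq X) (fun l s =>
    (forall x, x \in s -> x \notin flatten l) /\
    (forall M, L (size l) M -> exists2 x, x \in s & S M x)).
  have /choice[p pP] M : exists x,
      infinite_set (S M) -> S M x /\ x \notin flatten l.
    have [|iS] := pselect (finite_set (S M)); first by exists x0.
    have [x [Sx /negP xl]] :=
      infinite_setN0 (infinite_setD iS (finite_seq (flatten l))).
    by exists x.
  have /finite_seqP[s sE] := finite_image p (finL (size l)).
  exists s; split.
    move=> x xs; have : [set` s] x by [].
    by rewrite -sE => -[M [_ _ /pP[_ nl]] <-].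
  move=> M LM; exists (p M); last by case: LM => _ _ /pP[].
  suff : [set` s] (p M) by [].
  by rewrite -sE; exists M.
have t_disjoint m n x : x \in t m -> (m < n)%N -> x \notin t n.
  move=> xm mn; apply/negP => /(tP n).1 /negP; apply.
  by apply/flattenP; exists (t m) => //; apply/map_f; rewrite mem_iota.
have tc : (fun n => tv (t n) y c) @ \oo --> tv [::] c c.
  move=> U /nbhs_agree[s sU].
  have : \forall n \near \oo, forall x, x \in s -> x \notin t n.
    apply: (@filter_forall_seq X _ _ s (fun x => [set n | x \notin t n])) => x _.
    have [[m xm]|nx] := pselect (exists m, x \in t m).
      by exists m.+1 => // n /= mn; exact: t_disjoint mn.
    by exists 0%N => // n _ /=; apply/negP => xn; apply: nx; exists n.
  by apply: filterS => n sn; apply: sU => x /sn; exact: tv_notin.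
apply: (@sub_countable _ _ _
    (\bigcup_(M in N `&` [set M | finite_set (S M)]) S M)); last first.
  apply: bigcup_countable => [|M [_]]; last exact: finite_set_countable.
  by apply: sub_countable cN; apply: subset_card_le => M [].
apply: subset_card_le => x _.
have [|M [NM Mc MO iM]] := netN _ [set h | set_val h x <> y] tc.
  by apply: nbhs_eval_neq => /= /esym.
exists M; last by move=> h /MO.
split => //; apply: contrapT => iS; apply: iM.
apply: sub_finite_set (finite_II (e M).+1) => n /= Mn.
rewrite ltnS leqNgt; apply/negP => eMn.
have [z zt Sz] : exists2 x, x \in t n & S M x.
  by apply: (tP n).2; rewrite size_mkseq; split.
by apply: Sz Mn _; exact: tv_in.
Qed.

Let tv_slice (c y : Y) n : set (set_type H) :=
  [set h | exists2 s : seq X, (size s <= n)%N & h = tv s c y].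

Let closed_tv_slice (c y : Y) n : y <> c -> closed (tv_slice c y n).
Proof.
move=> yc h clh.
have h_cy x : set_val h x = c \/ set_val h x = y.
  apply: contrapT => /not_orP[hc hy].
  have [_ [[s _ ->] [/= gc gy]]] :=
    clh _ (filterI (nbhs_eval_neq hc) (nbhs_eval_neq hy)).
  by case: (boolP (x \in s)) => [/tv_in|/tv_notin] e;
    [apply: gc|apply: gy]; exact: e.
pose P := [set x | set_val h x = c].
have P_small s : uniq s -> [set` s] `<=` P -> (size s <= n)%N.
  move=> us sP.
  have : nbhs h [set g | forall x, x \in s -> set_val g x <> y].
    apply: filter_forall_seq => x xs; apply: nbhs_eval_neq.
    by rewrite sP // => /esym.
  move=> /clh[_ [[t tn ->] ht]]; apply: leq_trans tn.
  apply: uniq_leq_size => //.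
  by move=> x /ht hx; apply: contrapT => /negP /(@tv_notin t c y x).
have /finite_seqP[s sP] : finite_set P.
  apply: contrapT => /(infinite_set_fset n.+1)[B BP].
  by rewrite ltnNge P_small ?finmap.fset_uniq.
exists (undup s).
  apply: P_small; first exact: undup_uniq.
  by move=> x /=; rewrite mem_undup sP.
apply: val_inj; apply/funext => x /=; rewrite /two_valued mem_undup.
have -> : (x \in s) = (x \in P) by rewrite sP; apply/idP/idP; rewrite inE.
by case: ifPn => [|/negP]; rewrite inE //; case: (h_cy x).
Qed.

(** Kelley's example of a product that is not a k-space.  The set [A] of
functions equal to some [y n] off at most [n] points, where they are [c], has
the constant [c] as a limit point.  In a compact [K] each coordinate meets only
finitely many [y n]; if [X] is uncountable then one bound [k] serves
infinitely many coordinates, and a function in [A] with parameter [n > k] that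
lies in [K] would have to be [c] at all of them; so only finitely many of the
closed slices of [A] meet [K]. *)
Lemma k_space_countable (y : nat -> Y) (c : Y) :
  (forall n, y n <> c) ->
  (forall p : Y, exists2 U, nbhs p U & \forall n \near \oo, ~ U (y n)) ->
  k_space (set_type H) -> countable [set: X].
Proof.
move=> yc y_escapes kH; apply: contrapT => ncX.
pose A := \bigcup_n tv_slice c (y n) n.
have nclA : ~ closed A.
  move=> clA; have [|n _ [s _]] := clA (tv [::] c c).
    move=> U /nbhs_agree[s sU]; exists (tv s c (y (size s))); split.
      by exists (size s) => //; exists s.
    by apply: sU => x xs; rewrite tv_in.
  move=> /(congr1 set_val) cs; apply: ncX; apply: finite_set_countable.
  apply: sub_finite_set (finite_seq s) => x _ /=; apply: contrapT => /negP xs.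
  by apply: (yc n); rewrite -(@tv_notin s c (y n) x xs) -cs.
have [K cK] := kH A nclA; apply.
have /choice[m mP] x : exists m, forall n, (m <= n)%N ->
    forall h, K h -> set_val h x <> y n.
  have : \forall n \near \oo, K `<=` [set h | set_val h x <> y n].
    apply: ((compact_near_coveringP K).1 cK nat \oo) => h Kh.
    have [U hU [m _ Um]] := y_escapes (set_val h x).
    exists ([set g : set_type H | U (set_val g x)], [set n | (m <= n)%N]).
      by split; [exact: nbhs_eval|exists m].
    by move=> [g n] /= [Ug mn] gn; apply: (Um n mn); rewrite -gn.
  by case=> m _ mP; exists m => n /mP.
have [k ik] : exists k, infinite_set [set x | (m x <= k)%N].
  apply: contrapT => /forallNP fin; apply: ncX.
  apply: (@sub_countable _ _ _ (\bigcup_k [set x | (m x <= k)%N])).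
    by apply: subset_card_le => x _; exists (m x) => //=.
  apply: bigcup_countable => // k _; apply: finite_set_countable.
  exact: contrapT (fin k).
have AK : A `&` K = (\bigcup_(n in `I_k.+1) tv_slice c (y n) n) `&` K.
  apply/seteqP; split=> h [[n /= nk sh] Kh]; split=> //; last by exists n.
  exists n => //=; rewrite ltnS leqNgt; apply/negP => kn; apply: ik.
  have [s _ hs] := sh; apply: sub_finite_set (finite_seq s) => x /= mk.
  apply: contrapT => /negP /(@tv_notin s c (y n)); rewrite -hs.
  by apply: mP Kh; exact: leq_trans mk (ltnW kn).
apply/closed_subspaceP; exists (\bigcup_(n in `I_k.+1) tv_slice c (y n) n).
  by apply: closed_bigcup => [|n _]; [exact: finite_II|exact: closed_tv_slice].
by rewrite AK -setIA setIid.
Qed.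

End two_valued_space.

Theorem corollary5p22 (R : realType) (X Y : topologicalType)
    (H : set {ptws X -> Y})
    (Y_metrizable : metrizable R Y)
    (Y_noncompact : ~ compact [set: Y])
    (X_YTychonoff : Y_Tychonoff X Y)
    (X_pseudo : countable_pseudocharacter X)
    (H_sub_Baire : H `<=` Baire_functions X Y)
    (stable_sub_H : stable_Baire_one X Y `<=` H) :
  [<-> metrizable R (set_type H) /\ H = [set: {ptws X -> Y}];
       k_space (set_type H);
       countable_tightness (set_type H);
       sigma_space (set_type H);
       countable_cs_star_character (set_type H);
       countable [set: X]].
Proof.
have [d dY] := Y_metrizable.
have Y_hausdorff : hausdorff_space Y by exact: metrizes_hausdorff dY.
have H_tv s y c : H (two_valued s y c).
  by apply: stable_sub_H; exact: stable_Baire_one_two_valued.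
have [y0 y0_escapes] := metrizes_noncompact_sequence dY Y_noncompact.
have [c [y [yc y_escapes]]] : exists (c : Y) (y : nat -> Y),
    (forall n, y n <> c) /\
    forall p : Y, exists2 U, nbhs p U & \forall n \near \oo, ~ U (y n).
  have [U cU [N _ NU]] := y0_escapes (y0 0%N).
  exists (y0 0%N), (fun n => y0 (n + N)%N); split.
    move=> n ync; apply: (NU (n + N)%N); first exact: leq_addl.
    by rewrite ync; exact: nbhs_singleton.
  move=> p; have [V pV [m _ mV]] := y0_escapes p; exists V => //.
  by exists m => // n /= mn; apply: mV; exact: leq_trans mn (leq_addr _ _).
have cX_full : countable [set: X] -> metrizable R (set_type H) /\ H = setT.
  move=> cX; split.
    by apply: metrizable_set_type; exact: metrizable_ptws_countable.
  apply/seteqP; split => //.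
  rewrite -(stable_Baire_one_countable c X_YTychonoff cX).
  exact: stable_sub_H.
have cX_metrizes : countable [set: X] ->
    exists d : set_type H -> set_type H -> R, metrizes d.
  by move=> /cX_full[].
tfae.
- by move=> [[dH dHP] _]; exact: metrizes_k_space dHP.
- move=> /(k_space_countable Y_hausdorff H_tv yc y_escapes) /cX_metrizes[dH].
  exact: metrizes_countable_tightness.
- move=> /(countable_tightness_countable Y_hausdorff H_tv (yc 0%N)).
  move=> /cX_metrizes[dH]; exact: metrizes_sigma_space.
- move=> /(sigma_space_countable Y_hausdorff H_tv (yc 0%N)) /cX_metrizes[dH].
  exact: metrizes_countable_cs_star_character.
- exact: (cs_star_countable Y_hausdorff H_tv (yc 0%N)).
- exact: cX_full.
Qed.
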